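(* Let $B$ be a Bratteli diagram with incidence matrices $\{F_n\}_{n=0}^\infty$, let $\overline B$ be a vertex subdiagram of $B$ defined by a sequence of subsets $W_n \subset V_n$, and let $\mu$ be a probability $\mathcal E$-invariant measure on $X_B$. Let $Y^{(n)}_{\overline B}$ be the set of all paths $x=(x_1,x_2,\dots)\in X_B$ such that the finite path $(x_1,\dots,x_n)$ lies in $\overline B$. Then the series $$S = \sum_{n=1}^{\infty} \sum_{v \in W'_{n+1}} \sum_{w \in W_{n}} f_{v,w}^{(n)} p_v^{(n+1)}\overline h_{w}^{(n)}$$ is always convergent and $\mu(X_{\overline B}) = \mu(Y^{(1)}_{\overline B}) - S$. Hence, $$\mu(X_{\overline{B}}) = 0 \quad \Longleftrightarrow \quad S = \mu(Y^{(1)}_{\overline B}).$$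
   Context: A Bratteli diagram $B=(V,E)$ is an infinite graph with $V=\bigcup_{i\ge 0}V_i$, $E=\bigcup_{i\ge1}E_i$ (disjoint finite levels, $V_0=\{v_0\}$), with range and source maps $r,s$ on edges such that $r(E_i)=V_i$, $s(E_i)=V_{i-1}$, $s^{-1}(v)\ne\emptyset$ for all $v$, and $r^{-1}(v)\neq\emptyset$ for all $v\ne v_0$. The $n$-th incidence matrix is $F_n=(f^{(n)}_{v,w})_{v\in V_{n+1},w\in V_n}$, where $f^{(n)}_{v,w}$ is the number of edges from $w$ to $v$. $X_B$ is the space of infinite paths starting at $v_0$ with the cylinder topology, assumed to be a Cantor set. Two paths are tail equivalent, $(x,y)\in\mathcal E$, if they agree from some index on. A measure is $\mathcal E$-invariant if any two cylinder sets given by finite paths from $v_0$ to the same vertex have equal measure; $p^{(n)}_v$ is the $\mu$-measure of the cylinder set of any finite path from $v_0$ to $v\in V_n$. A vertex subdiagram $\overline B$ is given by proper nonempty subsets $W_n\subset V_n$ ($n\ge1$), with $W'_n=V_n\setminus W_n\neq\emptyset$ (and $v_0$ at level $0$): its edges are all edges of $B$ with source in $W_n$ and range in $W_{n+1}$, together with the edges from $v_0$ to $W_1$. It is required that every vertex of $\overline B$ is the source of some edge of $\overline B$ and every vertex of $\overline B$ other than $v_0$ is the range of some edge of $\overline B$. $X_{\overline B}\subset X_B$ is its set of infinite paths, and $\overline h^{(n)}_w$ is the number of finite paths in $\overline B$ from $v_0$ to $w\in W_n$. *)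

(* Defs.v *)
From HB Require Import structures.
From mathcomp Require Import all_boot all_order all_algebra.
From mathcomp Require Import finmap.
From mathcomp Require Import all_classical all_reals all_analysis.
Set Implicit Arguments.
Unset Strict Implicit.
Unset Printing Implicit Defensive.
Import Order.TTheory GRing.Theory Num.Theory.
Import numFieldNormedType.Exports.
Local Open Scope classical_set_scope.

(* Levels are indexed by types, hence disjoint.  Edges are indexed by their
   source level: [edge B n] is E_(n+1), its elements go from V_n to V_(n+1). *)
Record bratteli := Bratteli {
  vertex : nat -> finType;
  edge : nat -> finType;
  src : forall n, edge n -> vertex n;
  rng : forall n, edge n -> vertex n.+1;
  card_vertex0 : #|vertex 0| = 1;
  src_surj : forall n (v : vertex n), exists e : edge n, src e = v;
  rng_surj : forall n (v : vertex n.+1), exists e : edge n, rng e = v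
}.
Arguments src {b n}.
Arguments rng {b n}.

(* f^(n)_(v,w), the entries of F_n. *)
Definition incidence (B : bratteli) n (v : vertex B n.+1) (w : vertex B n)
  : nat := #|[set e : edge B n | (src e == w) && (rng e == v)]|.

(* Level 0 has a single vertex, so every such path starts at v_0.  The paper's
   edge x_(n+1) is [x n]. *)
Record inf_path (B : bratteli) := InfPath {
  path_edge :> forall n, edge B n;
  path_edgeP : forall n, rng (path_edge n) = src (path_edge n.+1)
}.

(* Finite paths from v_0 to v : a path to v at level n.+1 is a last edge into v
   together with a path to its source. *)
Fixpoint fin_path (B : bratteli) n : vertex B n -> finType :=
  match n return vertex B n -> finType with
  | 0 => fun _ => unit
  | m.+1 => fun v =>
      {e : {e : edge B m | rng e == v} & fin_path (src (val e))}
  end.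

Fixpoint extends (B : bratteli) (x : inf_path B) n
  : forall v : vertex B n, fin_path v -> Prop :=
  match n return forall v : vertex B n, fin_path v -> Prop with
  | 0 => fun _ _ => True
  | m.+1 => fun v f => x m = val (tag f) /\ extends x (tagged f)
  end.

Definition cylinder (B : bratteli) n (v : vertex B n) (f : fin_path v)
  : set (inf_path B) := [set x | extends x f].

Definition cylinders (B : bratteli) : set (set (inf_path B)) :=
  [set C | exists n (v : vertex B n) (f : fin_path v), C = cylinder f].

Lemma inf_path_inh (B : bratteli) : exists x : inf_path B, True.
Proof.
have next n (e : edge B n) : {e' : edge B n.+1 | rng e = src e'}.
  by apply: cid; have [e' <-] := src_surj (rng e); exists e'.
have /card_gt0P/cid[v0 _] : 0 < #|vertex B 0| by rewrite card_vertex0.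
have /cid[e0 _] := src_surj v0.
pose x := fix x n : edge B n :=
  if n is m.+1 then sval (next m (x m)) else e0.
by exists (@InfPath B x (fun n => svalP (next n (x n)))).
Qed.

HB.instance Definition _ (B : bratteli) := gen_eqMixin (inf_path B).
HB.instance Definition _ (B : bratteli) := gen_choiceMixin (inf_path B).
HB.instance Definition _ (B : bratteli) :=
  isPointed.Build (inf_path B) (sval (cid (inf_path_inh B))).
HB.instance Definition _ (B : bratteli) :=
  isSubBaseTopological.Build (inf_path B) (@cylinders B) id.

Definition is_cantor_set (T : topologicalType) : Prop :=
  exists (f : T -> cantor_space) (g : cantor_space -> T),
    [/\ cancel f g, cancel g f, continuous f & continuous g].

Definition borel_paths (B : bratteli)
  : measurableType (@open (inf_path B)).-sigma :=
  g_sigma_algebraType (@open (inf_path B)).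

Definition tail_invariant (R : realType) (B : bratteli)
    (mu : {measure set (borel_paths B) -> \bar R}%R) : Prop :=
  forall n (v : vertex B n) (f g : fin_path v),
    mu (cylinder f) = mu (cylinder g).

Lemma fin_path_inh (B : bratteli) n (v : vertex B n) : exists f : fin_path v, true.
Proof.
elim: n v => [|n IHn] v; first by exists tt.
have [e /eqP ev] := rng_surj v; have [f _] := IHn (src e).
by exists (Tagged (fun e : {e | rng e == v} => fin_path (src (val e)))
  (f : fin_path (src (val (exist (fun e => rng e == v) e ev))))).
Qed.

(* p_v^(n), read off an arbitrary finite path; see [vertex_measureE]. *)
Definition vertex_measure (R : realType) (B : bratteli)
    (mu : probability (borel_paths B) R) n (v : vertex B n) : R :=
  fine (mu (cylinder (xchoose (fin_path_inh v)))).

Lemma measurable_cylinder (B : bratteli) n (v : vertex B n) (f : fin_path v) :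
  measurable (cylinder f : set (borel_paths B)).
Proof.
apply: sub_sigma_algebra; exists [set cylinder f]; last by rewrite bigcup_set1.
move=> _ ->; exists [fset cylinder f]%fset.
  by move=> C /fset1P ->; rewrite in_setE; exists n; exists v; exists f.
by rewrite set_fset1 bigcap_set1.
Qed.

Lemma vertex_measureE (R : realType) (B : bratteli)
    (mu : probability (borel_paths B) R) n (v : vertex B n) (f : fin_path v) :
  tail_invariant mu -> mu (cylinder f) = (vertex_measure mu v)%:E.
Proof.
move=> inv; rewrite /vertex_measure fineK; first exact: inv.
by rewrite fin_num_measure //; exact: measurable_cylinder.
Qed.

Definition sub_edge (B : bratteli) (W : forall n, {set vertex B n}) n
  : {set edge B n} := [set e | (src e \in W n) && (rng e \in W n.+1)].

(* [sub_level0] makes every edge from v_0 to W_1 an edge of the subdiagram. *)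
Record is_vertex_subdiagram (B : bratteli) (W : forall n, {set vertex B n})
  : Prop := IsVertexSubdiagram {
  sub_level0 : W 0 = [set: vertex B 0]%SET;
  sub_nonempty : forall n, 0 < n -> W n != finset.set0;
  sub_proper : forall n, 0 < n -> (~: W n)%SET != finset.set0;
  sub_source : forall n (w : vertex B n), w \in W n ->
    exists2 e, e \in sub_edge W n & src e = w;
  sub_range : forall n (w : vertex B n.+1), w \in W n.+1 ->
    exists2 e, e \in sub_edge W n & rng e = w
}.

Definition sub_paths (B : bratteli) (W : forall n, {set vertex B n})
  : set (inf_path B) := [set x | forall i, x i \in sub_edge W i].

Definition sub_paths_upto (B : bratteli) (W : forall n, {set vertex B n}) n
  : set (inf_path B) := [set x | forall i, i < n -> x i \in sub_edge W i].

Fixpoint fin_path_in (B : bratteli) (W : forall n, {set vertex B n}) n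
  : forall v : vertex B n, fin_path v -> bool :=
  match n return forall v : vertex B n, fin_path v -> bool with
  | 0 => fun _ _ => true
  | m.+1 => fun v f =>
      (val (tag f) \in sub_edge W m) && fin_path_in W (tagged f)
  end.

Definition sub_height (B : bratteli) (W : forall n, {set vertex B n}) n
  (w : vertex B n) : nat := #|[set f : fin_path w | fin_path_in W f]|.

(* Main.v *)
Require Import Defs.
From mathcomp Require Import all_boot all_order all_algebra.
From mathcomp Require Import all_classical all_reals all_analysis.
Set Implicit Arguments.
Unset Strict Implicit.
Unset Printing Implicit Defensive.
Import Order.TTheory GRing.Theory Num.Theory.
Import numFieldNormedType.Exports.
Local Open Scope classical_set_scope.
Local Open Scope ring_scope.

(** Let Y_n be the set of paths whose first n edges lie in the subdiagram.  The
    sets Y_n decrease to the path space of the subdiagram, so the measure of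
    that space is the limit of mu Y_n, all measures being finite.

    A path of Y_n outside Y_(n+1) follows the subdiagram down to some w in W_n
    and then takes an edge to a vertex v outside W_(n+1): as a vertex subdiagram
    contains every edge between its own vertices, the edge can be missing only
    because of its range (sub_paths_upto_setD).  Hence Y_n minus Y_(n+1) is the
    disjoint union of the cylinders of such prefixes, and invariance turns
    its measure into a count: for fixed v, each cylinder has measure p_v, and
    the prefixes are counted by choosing w, one of the f_(v,w) edges and
    one of the paths of the subdiagram to w (card_exits).  So the n-th term of S
    is exactly mu Y_n - mu Y_(n+1) (measure_sub_paths_uptoB), the partial sums
    telescope, and continuity from above gives both the convergence and the
    value of S. *)

(** * Prefixes of infinite paths *)

Lemma extends_prefix (B : bratteli) (x : inf_path B) n :
  exists f : fin_path (src (x n)), extends x f.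
Proof.
elim: n => [|n [f xf]]; first by exists tt.
have xn : rng (x n) == src (x n.+1) by apply/eqP/path_edgeP.
pose e := exist (fun e => rng e == src (x n.+1)) (x n) xn.
by exists (Tagged (fun e : {e | rng e == src (x n.+1)} =>
  fin_path (src (val e))) (f : fin_path (src (val e)))).
Qed.

(** Cylinders of distinct finite paths of the same length are disjoint.  The
    end vertices are part of the conclusion, hence the tagged paths; at level 0
    they agree because there is only one vertex. *)
Lemma extends_inj (B : bratteli) (x : inf_path B) n
    (v w : vertex B n) (f : fin_path v) (g : fin_path w) :
  extends x f -> extends x g -> Tagged (fun u : vertex B n => fin_path u) f =
  Tagged (fun u : vertex B n => fin_path u) g.
Proof.
elim: n v w f g => [|n IHn] v w.
  have /fintype_le1P/(_ v w)-> : (#|vertex B 0| <= 1)%N by rewrite card_vertex0.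
  by move=> [] [].
move=> [[e ev] /= f] [[e' ev'] /= g] [xe xf] [xe' xg].
have ee' : e = e' by rewrite -xe -xe'.
case: _ / ee' ev' g xg {xe'} => ev' g xg.
have vw : v = w by rewrite -(eqP ev) -(eqP ev').
case: _ / vw ev' => ev'.
rewrite (bool_irrelevance ev' ev).
by have /eqP := IHn _ _ _ _ xf xg; rewrite eq_Tagged => /eqP /= ->.
Qed.

(** * Measure of a set determined by prefixes of fixed length *)

Definition paths_through {B : bratteli} {n}
    (P : forall v : vertex B n, pred (fin_path v)) : set (borel_paths B) :=
  [set x | exists v (f : fin_path v), P v f /\ extends x f].

Lemma paths_throughE (B : bratteli) n
    (P : forall v : vertex B n, pred (fin_path v)) :
  paths_through P =
  \bigcup_(p in [set p : {v : vertex B n & fin_path v} |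
                    P (tag p) (tagged p)]) cylinder (tagged p).
Proof.
apply/seteqP; split=> x /=.
  by move=> [v [f [Pf xf]]];
    exists (Tagged (fun v : vertex B n => fin_path v) f).
by move=> [[v f] /= Pf xf]; exists v, f.
Qed.

Lemma measurable_paths_through (B : bratteli) n
    (P : forall v : vertex B n, pred (fin_path v)) :
  measurable (paths_through P).
Proof.
rewrite paths_throughE; apply: fin_bigcup_measurable => [|p _].
  exact: finite_finset.
exact: measurable_cylinder.
Qed.

(** The prefixes index a finite disjoint union of cylinders, and invariance makes
    the measure of each depend only on its end vertex, so only the number of
    prefixes ending at each vertex matters. *)
Lemma measure_paths_through (R : realType) (B : bratteli)
    (mu : probability (borel_paths B) R) n
    (P : forall v : vertex B n, pred (fin_path v)) : tail_invariant mu ->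
  mu (paths_through P) =
  (\sum_(v : vertex B n) #|[pred f | P v f]|%:R * vertex_measure mu v)%:E.
Proof.
move=> inv; rewrite paths_throughE measure_fin_bigcup.
- rewrite -(@bigfs _ _ _ _ (index_enum _)
    [pred p : {v : vertex B n & fin_path v} | P (tag p) (tagged p)]);
    [|exact: index_enum_uniq|by move=> p _; rewrite mem_index_enum].
  rewrite -(@sig_big_dep _ _ _ _ _ xpredT P (fun v f => mu (cylinder f))) /=.
  rewrite -sumEFin; apply: eq_bigr => v _.
  under eq_bigr do rewrite (vertex_measureE _ inv).
  by rewrite sumEFin sumr_const mulr_natl.
- exact: finite_finset.
- move=> [v f] [w g] _ _ [x [/= xf xg]].
  exact: extends_inj xf xg.
- by move=> p _; exact: measurable_cylinder.
Qed.

(** * Leaving the subdiagram *)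

Lemma fin_path_inP (B : bratteli) (W : forall n, {set vertex B n})
    (x : inf_path B) n (v : vertex B n) (f : fin_path v) :
  extends x f -> fin_path_in W f <-> sub_paths_upto W n x.
Proof.
elim: n v f => [|n IHn] v /=; first by split.
move=> [e f] /= [xe xf]; have {}IHn := IHn _ _ xf.
split=> [/andP[en /IHn xW] i|xW].
  by rewrite ltnS leq_eqVlt => /predU1P[->|/xW //]; rewrite xe.
by rewrite -[X in X \in _]xe xW //=; apply/IHn => i /ltnW; exact: xW.
Qed.

Lemma sub_paths_uptoE (B : bratteli) (W : forall n, {set vertex B n}) n :
  sub_paths_upto W n =
  paths_through (fun (v : vertex B n) f => fin_path_in W f).
Proof.
apply/seteqP; split=> x.
  have [f xf] := extends_prefix x n.
  by move=> /(fin_path_inP _ xf) fW; exists (src (x n)), f.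
by move=> [v [f [fW xf]]]; apply/(fin_path_inP _ xf).
Qed.

(** The last edge of a nonempty path lies in the subdiagram, hence so does its
    range; the hypothesis on [W 0] covers the empty path. *)
Lemma fin_path_in_range (B : bratteli) (W : forall n, {set vertex B n})
    n (v : vertex B n) (f : fin_path v) :
  W 0%N = [set: vertex B 0]%SET -> fin_path_in W f -> v \in W n.
Proof.
move=> W0; case: n v f => [|n] v; first by rewrite W0 inE.
by move=> [[e /= /eqP <-] f] /andP[]; rewrite inE => /andP[].
Qed.

Definition exits {B : bratteli} (W : forall n, {set vertex B n}) n
    (v : vertex B n.+1) : pred (fin_path v) :=
  fun f => (v \notin W n.+1) && fin_path_in W (tagged f).
Arguments exits {B} W n v _.

(** Since the prefix of length n already ends in [W n], the source of the next
    edge is in the subdiagram, so the edge is outside it exactly when its range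
    is. *)
Lemma sub_paths_upto_setD (B : bratteli) (W : forall n, {set vertex B n}) n :
  W 0%N = [set: vertex B 0]%SET ->
  sub_paths_upto W n `\` sub_paths_upto W n.+1 = paths_through (exits W n).
Proof.
move=> W0; apply/seteqP; split=> x.
  have [f xf] := extends_prefix x n.+1.
  move=> [xW /(fin_path_inP _ xf)/negP /= nxW].
  exists (src (x n.+1)), f; split=> //.
  case: f xf nxW => [e f] /= [xe xf]; have [fW _] := fin_path_inP W xf.
  have {xW} fW : fin_path_in W f by apply/(fin_path_inP _ xf).
  rewrite /exits /= fW !andbT inE (fin_path_in_range W0 fW).
  by rewrite (eqP (valP e)).
move=> [v [[e f] [/andP[/= vW fW] [xe xf]]]]; split.
  exact/(fin_path_inP _ xf).
move=> /(_ n (ltnSn n)); rewrite inE xe => /andP[_].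
by rewrite (eqP (valP e)) (negPf vW).
Qed.

(** * Counting exits *)

(** [sub_height] and [incidence] are cardinals of classical sets; in this form
    and the next they become sizes of boolean predicates, which can be summed
    over. *)
Lemma sub_heightE (B : bratteli) (W : forall n, {set vertex B n})
    n (w : vertex B n) :
  sub_height W w = #|[pred f : fin_path w | fin_path_in W f]|.
Proof. by apply: eq_card => f; apply/idP/idP; rewrite in_setE. Qed.

Lemma incidenceE (B : bratteli) n (v : vertex B n.+1) (w : vertex B n) :
  incidence v w = #|[pred e : edge B n | (src e == w) && (rng e == v)]|.
Proof. by apply: eq_card => e; apply/idP/idP; rewrite in_setE. Qed.

Lemma sub_height_notin (B : bratteli) (W : forall n, {set vertex B n})
    n (w : vertex B n) : W 0%N = [set: vertex B 0]%SET ->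
  w \notin W n -> sub_height W w = 0%N.
Proof.
move=> W0 wW; rewrite sub_heightE; apply: eq_card0 => f; rewrite inE.
by apply: contraNF wW => /(fin_path_in_range W0).
Qed.

(** An exit at [v] is an edge into [v] preceded by a path of the subdiagram to
    its source; grouping the edges by their source [w] gives the sum, sources
    outside [W n] contributing nothing. *)
Lemma card_exits (B : bratteli) (W : forall n, {set vertex B n}) n
    (v : vertex B n.+1) : W 0%N = [set: vertex B 0]%SET -> v \notin W n.+1 ->
  #|[pred f | exits W n v f]| =
  (\sum_(w in W n) incidence v w * sub_height W w)%N.
Proof.
move=> W0 vW; rewrite -sum1_card.
transitivity (\sum_(e : {e : edge B n | rng e == v}) sub_height W (src (val e)))%N.
  under [RHS]eq_bigr do rewrite sub_heightE -sum1_card.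
  rewrite (@sig_big_dep _ _ _ _ _ xpredT
    (fun e (f : fin_path (src (val e))) => fin_path_in W f)
    (fun _ _ => 1%N)) /=.
  by apply: eq_bigl => f; rewrite !inE /exits vW.
transitivity (\sum_(e : edge B n | rng e == v) sub_height W (src e))%N.
  exact: esym (big_sub [pred e | rng e == v] (fun e => sub_height W (src e))).
rewrite (bigID (fun e : edge B n => src e \in W n)) /= [X in (_ + X)%N]big1 ?addn0;
  last by move=> e /andP[_]; exact: sub_height_notin.
rewrite (partition_big src (mem (W n))) /=; last by move=> e /andP[].
apply: eq_bigr => w wW; rewrite incidenceE -sum_nat_const.
apply: eq_big => [e|e /andP[_ /eqP->] //].
by rewrite inE andbC; case: eqP => //= ->; rewrite wW andbT.
Qed.

(** * Telescoping *)

Lemma sub_paths_bigcap (B : bratteli) (W : forall n, {set vertex B n}) :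
  sub_paths W = \bigcap_n sub_paths_upto W n.
Proof.
apply/seteqP; split=> x xW => [n _ i _|i]; first exact: xW.
exact: (xW i.+1).
Qed.

Lemma nonincreasing_sub_paths_upto (B : bratteli)
    (W : forall n, {set vertex B n}) :
  nonincreasing_seq (sub_paths_upto W).
Proof.
move=> m n mn; apply/subsetPset => x xW i im.
exact: xW (leq_trans im mn).
Qed.

Lemma measurable_sub_paths_upto (B : bratteli)
    (W : forall n, {set vertex B n}) n :
  measurable (sub_paths_upto W n : set (borel_paths B)).
Proof. by rewrite sub_paths_uptoE; exact: measurable_paths_through. Qed.

(** The n-th term of the series is the mass lost between Y_n and Y_(n+1), which
    is the mass of the exits at level n + 1. *)
Lemma measure_sub_paths_uptoB (R : realType) (B : bratteli)
    (mu : probability (borel_paths B) R) (W : forall n, {set vertex B n}) n :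
  W 0%N = [set: vertex B 0]%SET -> tail_invariant mu ->
  fine (mu (sub_paths_upto W n)) - fine (mu (sub_paths_upto W n.+1)) =
  \sum_(v in (~: W n.+1)%SET) \sum_(w in W n)
    (incidence v w)%:R * vertex_measure mu v * (sub_height W w)%:R.
Proof.
move=> W0 inv; have mY := @measurable_sub_paths_upto B W.
have finY k : mu (sub_paths_upto W k) \is a fin_num by exact: fin_num_measure.
have YS : sub_paths_upto W n.+1 `<=` sub_paths_upto W n.
  by apply/subsetPset; apply: nonincreasing_sub_paths_upto.
have Yoo : (mu (sub_paths_upto W n) < +oo)%E by rewrite ltey_eq finY.
have : mu (paths_through (exits W n)) =
    (mu (sub_paths_upto W n) - mu (sub_paths_upto W n.+1))%E.
  by rewrite -sub_paths_upto_setD // measureD // (setIidr YS).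
rewrite (measure_paths_through _ inv).
rewrite -(fineK (finY n)) -(fineK (finY n.+1)) -EFinB => -[/= <-].
rewrite (bigID (fun v => v \in W n.+1)) /= big1 ?add0r => [|v vW]; last first.
  by rewrite eq_card0 ?mul0r // => f; rewrite !inE /exits vW.
apply: eq_big => [v|v vW]; first by rewrite !inE.
rewrite card_exits // natr_sum mulr_suml; apply: eq_bigr => w _.
by rewrite natrM mulrAC.
Qed.

Theorem theorem4p1 (R : realType) (B : bratteli)
    (W : forall n : nat, {set vertex B n})
    (mu : probability (borel_paths B) R)
    (cantorB : is_cantor_set (inf_path B))
    (subW : is_vertex_subdiagram W)
    (mu_inv : tail_invariant mu) :
  let partial_sum := fun N : nat =>
    \sum_(1 <= n < N) \sum_(v in (~: W n.+1)%SET) \sum_(w in W n)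
      (incidence v w)%:R * vertex_measure mu v * (sub_height W w)%:R in
  let sumS : R := limn partial_sum in
  [/\ cvgn partial_sum,
      mu (sub_paths W) = (mu (sub_paths_upto W 1) - sumS%:E)%E
    & mu (sub_paths W) = 0%E <-> sumS%:E = mu (sub_paths_upto W 1)].
Proof.
move=> partial_sum sumS; have W0 := sub_level0 subW.
pose Y := sub_paths_upto W; pose y n := fine (mu (Y n)).
have finY n : mu (Y n) \is a fin_num.
  by apply: fin_num_measure; exact: measurable_sub_paths_upto.
have mX : measurable (sub_paths W : set (borel_paths B)).
  rewrite sub_paths_bigcap; apply: bigcap_measurable => // n _.
  exact: measurable_sub_paths_upto.
have finX : mu (sub_paths W) \is a fin_num by exact: fin_num_measure.
have psE n : partial_sum n.+1 = y 1%N - y n.+1.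
  rewrite /partial_sum (@telescope_sumr_eq _ _ _ (fun k => - y k)) //.
    by rewrite opprK addrC.
  by move=> k _; rewrite -measure_sub_paths_uptoB // opprK addrC.
have cvgY : y @ \oo --> fine (mu (sub_paths W)).
  apply: fine_cvg; rewrite fineK // sub_paths_bigcap.
  apply: nonincreasing_cvg_mu => //.
  - by rewrite ltey_eq finY.
  - by move=> n; exact: measurable_sub_paths_upto.
  - by rewrite -sub_paths_bigcap.
  - exact: nonincreasing_sub_paths_upto.
have cvgS : partial_sum @ \oo --> y 1%N - fine (mu (sub_paths W)).
  (* [psE] fails for the empty sum at index 0, so the sequence is shifted. *)
  rewrite -cvg_shiftS (_ : [sequence _]_n = fun n => y 1%N - y n.+1);
    last exact/funext.
  by apply: cvgB; [exact: cvg_cst|rewrite (cvg_shiftS y)].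
have sumSE : sumS = y 1%N - fine (mu (sub_paths W)) by exact: cvg_lim.
have muXE : mu (sub_paths W) = (mu (Y 1%N) - sumS%:E)%E.
  by rewrite -(fineK (finY 1%N)) -EFinB sumSE subKr fineK.
split; [by apply/cvg_ex; eexists; exact: cvgS|exact: muXE|].
rewrite muXE -(fineK (finY 1%N)) -EFinB; split=> [[/eqP]|[->]].
  by rewrite subr_eq0 => /eqP->.
by rewrite subrr.
Qed.
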